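(* Let $(R, \mathfrak{m})$ be a complete discrete valuation ring with finite residue field $R/\mathfrak{m} = \mathbb{F}_q$, and let $P(t) \in R[t]$ be a monic polynomial whose reduction modulo $\mathfrak{m}$ is an irreducible polynomial $\overline{P}(t) \in \mathbb{F}_q[t]$. For $d \in \mathbb{Z}_{\ge 0}$, define $b_n(d)$ ($n \in \mathbb{Z}_{\ge 0}$) by $$\sum_{n=0}^{\infty} b_n(d) u^n = \prod_{i=1}^{\infty} \frac{1 - (q^{-i}u)^d}{1 - q^{1-i}u} \in \mathbb{C}[[u]].$$ Then for every $n \in \mathbb{Z}_{\ge 0}$, $$\mathrm{Prob}_{A \in \mathrm{Mat}_n(R)}\big(\mathrm{coker}(P(A)) = 0\big) = b_n(\deg(P)) \prod_{i=1}^{n} (1 - q^{-i}).$$ Moreover, $$\lim_{n \to \infty} b_n(d) = \prod_{i=1}^{\infty} \frac{1 - q^{-id}}{1 - q^{-i}},$$ so in particular $$\lim_{n \to \infty} \mathrm{Prob}_{A \in \mathrm{Mat}_n(R)}\big(\mathrm{coker}(P(A)) = 0\big) = \prod_{i=1}^{\infty} (1 - q^{-i \deg(P)}).$$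
   Context: $\mathrm{Mat}_n(R)$ is the set of $n \times n$ matrices over $R$. $\mathrm{Prob}_{A \in \mathrm{Mat}_n(R)}$ denotes probability with respect to the Haar measure of total mass $1$ on the compact additive group $\mathrm{Mat}_n(R)$. For a matrix $B \in \mathrm{Mat}_n(R)$, $\mathrm{coker}(B)$ is the cokernel of the $R$-linear map $B : R^n \to R^n$. *)

(* Defs.v *)
From HB Require Import structures.
From mathcomp Require Import all_boot all_order all_algebra.
From mathcomp Require Import ring_quotient.
From mathcomp Require Import all_classical all_reals all_analysis.

Set Implicit Arguments.
Unset Strict Implicit.
Unset Printing Implicit Defensive.

Import Order.TTheory GRing.Theory Num.Theory.
Import numFieldNormedType.Exports.

Local Open Scope classical_set_scope.
Local Open Scope ring_scope.

Definition is_ideal (O : comPzRingType) (I : set O) : Prop :=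
  I 0 /\ forall a x y, I x -> I y -> I (a * x + y).

Definition is_principal (O : comPzRingType) (I : set O) : Prop :=
  exists a, I = range (fun x => x * a).

Definition is_prime_ideal (O : comPzRingType) (I : set O) : Prop :=
  [/\ is_ideal I, ~ I 1 & forall x y, I (x * y) -> I x \/ I y].

(* (O, m) is a discrete valuation ring: the integral domain O is a principal
   ideal domain, and m is its unique nonzero prime ideal. *)
Definition is_dvr (O : idomainType) (m : set O) : Prop :=
  [/\ forall I : set O, is_ideal I -> is_principal I,
      is_prime_ideal m,
      m <> [set 0] &
      forall I : set O, is_prime_ideal I -> I <> [set 0] -> I = m].

(* [smallest is_ideal G] is the ideal generated by G; the power 0 is O. *)
Definition ideal_pow (O : comPzRingType) (I : set O) (k : nat) : set O :=
  smallest (@is_ideal O)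
    [set \prod_(j < k) f j | f in [set f : 'I_k -> O | forall j, I (f j)]].

(* O endowed with the I-adic uniformity, hence with the I-adic topology. *)
Definition adic (O : comPzRingType) (I : set O) : Type := O.

Section AdicUniformity.
Variables (O : comPzRingType) (I : set O).
Local Open Scope relation_scope.

Definition adic_entourage : set_system (adic I * adic I) :=
  filter_from setT
    (fun k => [set xy | ideal_pow I k ((xy.1 : O) - (xy.2 : O))]).

Lemma is_ideal_pow k : is_ideal (ideal_pow I k).
Proof.
split=> [J [[]]//|a x y Ix Iy J [idJ sJ]].
by apply: idJ.2; [apply: Ix | apply: Iy].
Qed.

Lemma ideal_pow0 k : ideal_pow I k 0.
Proof. by have [] := is_ideal_pow k. Qed.

Lemma ideal_powD k x y :
  ideal_pow I k x -> ideal_pow I k y -> ideal_pow I k (x + y).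
Proof. by move=> Ix Iy; rewrite -[x]mul1r; apply: (is_ideal_pow k).2. Qed.

Lemma ideal_powN k x : ideal_pow I k x -> ideal_pow I k (- x).
Proof.
move=> Ix; rewrite -[- x]addr0 -mulN1r; apply: (is_ideal_pow k).2 => //.
exact: ideal_pow0.
Qed.

Lemma ideal_powS k : ideal_pow I k.+1 `<=` ideal_pow I k.
Proof.
move=> x; apply; split; first exact: is_ideal_pow.
move=> _ [f If <-] J [idJ sJ]; rewrite big_ord_recl -[_ * _]addr0.
apply: idJ.2; last exact: idJ.1.
by apply: sJ; exists (fun j => f (lift ord0 j)) => // j; apply: If.
Qed.

Lemma ideal_pow_sub j k : (j <= k)%N -> ideal_pow I k `<=` ideal_pow I j.
Proof.
elim: k => [|k IHk]; first by rewrite leqn0 => /eqP->.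
rewrite leq_eqVlt => /orP[/eqP->//|/IHk]; apply: subset_trans.
exact: ideal_powS.
Qed.

Lemma adic_entourage_filter : Filter adic_entourage.
Proof.
apply: filter_from_filter; first by exists 0%N.
move=> j k _ _; exists (maxn j k) => // xy Ixy.
by split; apply: ideal_pow_sub Ixy; rewrite ?leq_maxl ?leq_maxr.
Qed.

Lemma adic_entourage_diagonal A : adic_entourage A -> diagonal `<=` A.
Proof.
move=> [k _ sA] [x y] /= /diagonalP->; apply: sA.
by rewrite /= subrr; exact: ideal_pow0.
Qed.

Lemma adic_entourage_inv A : adic_entourage A -> adic_entourage A^-1.
Proof.
move=> [k _ sA]; exists k => // -[x y] /= Ixy; apply: sA => /=.
by rewrite -opprB; exact: ideal_powN.
Qed.

Lemma adic_entourage_split A :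
  adic_entourage A -> exists2 B, adic_entourage B & B \; B `<=` A.
Proof.
move=> [k _ sA].
exists [set xy | ideal_pow I k ((xy.1 : O) - (xy.2 : O))]; first by exists k.
move=> [x z] /= [y /= Ixy Iyz]; apply: sA => /=.
by rewrite -[x](subrK y) -addrA; exact: ideal_powD.
Qed.

HB.instance Definition _ := Choice.copy (adic I) O.
HB.instance Definition _ := isPointed.Build (adic I) (0 : O).
HB.instance Definition _ := isUniform.Build (adic I) adic_entourage_filter
  adic_entourage_diagonal adic_entourage_inv adic_entourage_split.

End AdicUniformity.

(* Completeness is existence of limits only; they are unique in a discrete
   valuation ring, where the powers of m intersect in 0. *)
Definition adic_complete (O : comPzRingType) (m : set O) : Prop :=
  forall F : set_system (adic m), ProperFilter F -> cauchy F -> cvg F.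

(* n x n matrices over O, with the Borel sigma-algebra of the product of the
   m-adic topologies. *)
Definition borel_mx (O : comPzRingType) (m : set O) (n : nat) :=
  g_sigma_algebraType (@open 'M[adic m]_n).

(* The normalized Haar measure is the unique translation-invariant Borel
   probability; regularity is automatic on a compact metrizable group. *)
Definition is_haar (R : realType) (O : comPzRingType) (m : set O) (n : nat)
    (mu : probability (borel_mx m n) R) : Prop :=
  forall (M : 'M[O]_n) (S : set 'M[O]_n),
    measurable (S : set (borel_mx m n)) -> mu [set M + A | A in S] = mu S.

(* [horner_mx] is only available for matrices of size n.+1, see [poly_mxE]. *)
Definition poly_mx (O : comNzRingType) (p : {poly O}) (n : nat) (A : 'M[O]_n)
    : 'M[O]_n :=
  \sum_(i < size p) p`_i *: A ^+ i.

Lemma poly_mxE (O : comNzRingType) (p : {poly O}) (n : nat) (A : 'M[O]_n.+1) :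
  poly_mx p A = horner_mx A p.
Proof.
rewrite -[in RHS](coefK p) poly_def rmorph_sum; apply: eq_bigr => i _.
by rewrite /= horner_mxZ rmorphXn /= horner_mx_X.
Qed.

Section Cokernel.
Variables (O : comPzRingType) (n : nat) (B : 'M[O]_n).

Definition im_mx : {pred 'cV[O]_n} :=
  fun v => `[< exists w : 'cV[O]_n, B *m w = v >].

Lemma im_mx_zmod_closed : zmod_closed im_mx.
Proof.
split; first by apply/asboolP; exists 0; rewrite mulmx0.
move=> _ _ /asboolP[v <-] /asboolP[w <-].
by apply/asboolP; exists (v - w); rewrite mulmxBr.
Qed.
HB.instance Definition _ :=
  GRing.isZmodClosed.Build 'cV[O]_n im_mx im_mx_zmod_closed.

Definition coker : zmodType := Quotient.quot im_mx.

End Cokernel.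

Definition coker_eq0 (O : comPzRingType) (n : nat) (B : 'M[O]_n) : Prop :=
  forall x : coker B, x = 0.

(* The formal power series \sum_n f n u^n is represented by f. *)
Section PowerSeries.
Variable F : fieldType.
Implicit Types f g : nat -> F.

Definition fps_of_poly (p : {poly F}) : nat -> F := fun n => p`_n.

Definition fps_one : nat -> F := fun n => (n == 0%N)%:R.

Definition fps_mul f g : nat -> F :=
  fun n => \sum_(i < n.+1) f i * g (n - i)%N.

Fixpoint fps_inv_seq f (n : nat) : seq F :=
  if n isn't n'.+1 then [::] else
  let s := fps_inv_seq f n' in
  rcons s ((f 0%N)^-1 * ((n' == 0%N)%:R - \sum_(i < n') f (n' - i)%N * s`_i)).

(* Inverse of f when [f 0%N != 0], see [fps_mulV] below. *)
Definition fps_inv f : nat -> F := fun n => (fps_inv_seq f n.+1)`_n.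

Definition fps_div f g : nat -> F := fps_mul f (fps_inv g).

Lemma size_fps_inv_seq f n : size (fps_inv_seq f n) = n.
Proof. by elim: n => //= n IHn; rewrite size_rcons IHn. Qed.

Lemma nth_fps_inv_seq f n i : (i < n)%N -> (fps_inv_seq f n)`_i = fps_inv f i.
Proof.
elim: n => // n IHn; rewrite ltnS leq_eqVlt => /orP[/eqP ->//|lt_in] /=.
by rewrite nth_rcons size_fps_inv_seq lt_in IHn.
Qed.

Lemma fps_mulV f : f 0%N != 0 -> fps_mul f (fps_inv f) = fps_one.
Proof.
move=> f0; apply/funext => n; rewrite /fps_mul /fps_one.
rewrite (reindex_inj rev_ord_inj) big_ord_recr /= subSS subnn.
rewrite (eq_bigr (fun i : 'I_n => f (n - i)%N * fps_inv f i)); last first.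
  by move=> i _; rewrite subSS subKn// ltnW.
rewrite subn0 [fps_inv f n]/fps_inv /= nth_rcons size_fps_inv_seq ltnn eqxx mulVKf//.
rewrite [X in _ - X](eq_bigr (fun i : 'I_n => f (n - i)%N * fps_inv f i)).
  by rewrite addrC subrK.
by move=> i _; rewrite nth_fps_inv_seq.
Qed.

End PowerSeries.

Section BCoefficients.
Variable R : realType.
Implicit Types q d i n N : nat.

Definition bfactor q d i : nat -> R :=
  fps_div (fps_of_poly (1 - (q%:R ^- i *: 'X) ^+ d))
          (fps_of_poly (1 - q%:R ^ (1 - i%:Z) *: 'X)).

(* The infinite product of power series is the coefficientwise limit of its
   partial products (its factors do not tend to 1 in the u-adic topology). *)
Definition bcoef q d n : R :=
  limn (fun N => (\big[@fps_mul R/@fps_one R]_(1 <= i < N.+1) bfactor q d i) n).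

(* The product of the f i over i >= 1. *)
Definition infprod (f : nat -> R) : R :=
  limn (fun N => \prod_(1 <= i < N.+1) f i).

End BCoefficients.

(* Main.v *)
(** The Haar measure pushes forward to the uniform measure on matrices over the
residue field F, and coker (P(A)) = 0 exactly when P(A mod m) is invertible, so
everything reduces to counting the A in Mat_n(F) with ker P(A) = 0. Here P
denotes the reduced polynomial, d its degree, q = #|F| and Q = q^d. For every A
the space ker P(A) is a vector space over F[t]/(P), so #|ker P(A)| = Q^r and the
number N_j(A) of its linearly independent j-tuples is prod_(i < j) (Q^r - Q^i).
By Gaussian binomial inversion the indicator of r = 0 is the sum over j of
(-1)^j N_j(A) / prod_(1 <= i <= j) (Q^i - 1). The average of N_j over A is
elementary: the Krylov family of such a j-tuple consists of dj independent
vectors, and conversely any dj independent vectors arise from exactly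
q^(n(n - dj)) matrices A. The result is the coefficient of u^n in the product of
the Euler expansions of prod_i (1 - (q^-i u)^d) and prod_i (1 - q^(1-i) u)^-1,
up to the factor prod_(i <= n) (1 - q^-i). The limits follow from Tannery's
theorem. *)

Require Import Defs.
From HB Require Import structures.
From mathcomp Require Import all_boot all_order all_algebra.
From mathcomp Require Import mxabelem zify lra ring.
From mathcomp Require Import all_classical all_reals all_analysis.

Import Order.TTheory GRing.Theory Num.Theory.
Import numFieldNormedType.Exports.

Local Open Scope classical_set_scope.
Local Open Scope ring_scope.

Set Implicit Arguments.
Unset Strict Implicit.
Unset Printing Implicit Defensive.

(** * Krylov spaces *)

Section Krylov.
Variables (F : fieldType) (n : nat).
Implicit Types (A : 'M[F]_n.+1) (P f : {poly F}).

(** Matrices act on row vectors from the right. When V P(A) = 0 and d = deg(P), the row space is the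
    F[t]-submodule generated by the rows of [V]. *)
Definition krylov d A j (V : 'M[F]_(j, n.+1)) : 'M[F]_(\sum_(e < d) j, n.+1) :=
  \mxcol_(e < d) (V *m A ^+ e).

Lemma horner_mxM A f g :
  horner_mx A (f * g) = horner_mx A f *m horner_mx A g.
Proof. exact: rmorphM. Qed.

Lemma horner_mxXn A e : horner_mx A 'X^e = A ^+ e.
Proof. by rewrite rmorphXn /= horner_mx_X. Qed.

Lemma horner_mx_sum A f d : (size f <= d)%N ->
  horner_mx A f = \sum_(i < d) f`_i *: A ^+ i.
Proof.
move=> lefd; rewrite -{1}(coefK f) (poly_def (size f)) (big_ord_widen d
  (fun i => f`_i *: 'X^i)) // big_mkcond rmorph_sum; apply: eq_bigr => i _ /=.
case: ltnP => [_|lefi]; last by rewrite rmorph0 nth_default // scale0r.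
by rewrite horner_mxZ rmorphXn /= horner_mx_X.
Qed.

Lemma krylov_sup d A j (V : 'M[F]_(j, n.+1)) e : (e < d)%N ->
  (V *m A ^+ e <= krylov d A V)%MS.
Proof.
move=> lt_ed; rewrite eqmx_col (sumsmx_sup (Ordinal lt_ed)) //=.
by rewrite genmxE.
Qed.

Lemma sub_krylov d A j (V : 'M[F]_(j, n.+1)) m (U : 'M[F]_(m, n.+1)) :
  (forall e, (e < d)%N -> V *m A ^+ e <= U)%MS -> (krylov d A V <= U)%MS.
Proof.
move=> VU; rewrite eqmx_col; apply/sumsmx_subP => e _.
by rewrite genmxE VU.
Qed.

Lemma krylov_horner_small d A j (V : 'M[F]_(j, n.+1)) f : (size f <= d)%N ->
  (V *m horner_mx A f <= krylov d A V)%MS.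
Proof.
move=> lefd; rewrite (horner_mx_sum _ lefd) mulmx_sumr summx_sub // => i _.
by rewrite -scalemxAr scalemx_sub // krylov_sup.
Qed.

Lemma krylov_col_mx d A j1 j2 (V1 : 'M[F]_(j1, n.+1)) (V2 : 'M[F]_(j2, n.+1)) :
  (krylov d A (col_mx V1 V2) :=: krylov d A V1 + krylov d A V2)%MS.
Proof.
apply/eqmxP; rewrite addsmx_sub; apply/andP; split.
  apply: sub_krylov => e lt_ed.
  by rewrite mul_col_mx -addsmxE addsmxS // krylov_sup.
by apply/andP; split; apply: sub_krylov => e lt_ed;
  apply: submx_trans (krylov_sup _ _ lt_ed); rewrite mul_col_mx -addsmxE
   ?addsmxSl ?addsmxSr.
Qed.

Variables (P : {poly F}) (d : nat) (sizeP : size P = d.+1).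

(** Division by P leaves a remainder of degree below d, and the multiple of P acts as zero on
    [V]. *)
Lemma krylov_horner A j (V : 'M[F]_(j, n.+1)) f : V *m horner_mx A P = 0 ->
  (V *m horner_mx A f <= krylov d A V)%MS.
Proof.
move=> VP0; have P0 : P != 0 by rewrite -size_poly_gt0 sizeP.
rewrite (divp_eq f P) mulrC rmorphD /= horner_mxM mulmxDr mulmxA VP0 mul0mx add0r.
by apply: krylov_horner_small; rewrite -ltnS -sizeP ltn_modp.
Qed.

Lemma krylov_stable A j (V : 'M[F]_(j, n.+1)) f : V *m horner_mx A P = 0 ->
  (krylov d A V *m horner_mx A f <= krylov d A V)%MS.
Proof.
move=> VP0; rewrite {1}/krylov mxcol_mul eqmx_col; apply/sumsmx_subP => e _.
rewrite genmxE -mulmxA.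
rewrite -horner_mxXn -horner_mxM; exact: krylov_horner.
Qed.

Lemma krylov_annihilated A j (V : 'M[F]_(j, n.+1)) : V *m horner_mx A P = 0 ->
  krylov d A V *m horner_mx A P = 0.
Proof.
move=> VP0; rewrite /krylov mxcol_mul -[RHS]mxcol0; apply: eq_mxcol => e.
by rewrite -mulmxA -horner_mxXn -horner_mxM mulrC horner_mxM mulmxA VP0 mul0mx.
Qed.

Hypothesis P_irr : irreducible_poly P.

(* By irreducibility, a nonzero polynomial of degree < d is invertible
   modulo P, so v can be recovered from its image under that polynomial. *)
Lemma krylov_mem A m (U : 'M[F]_(m, n.+1)) (v : 'rV_n.+1) f :
    v *m horner_mx A P = 0 -> (forall g, U *m horner_mx A g <= U)%MS ->
    f != 0 -> (size f <= d)%N -> (v *m horner_mx A f <= U)%MS -> (v <= U)%MS.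
Proof.
move=> vP0 Ust f0 lefd vfU.
have cPf : coprimep P f.
  rewrite irreducible_poly_coprime //; apply/negP => /dvdp_leq-/(_ f0).
  by rewrite sizeP leqNgt ltnS lefd.
have /Bezout_eq1_coprimepP[[u w] /= uw1] := cPf.
have -> : v = v *m horner_mx A f *m horner_mx A w.
  rewrite -mulmxA -[LHS]mulmx1 -[X in v *m X](rmorph1 (horner_mx A)) -uw1.
  rewrite mulrC (mulrC w) rmorphD /= !horner_mxM mulmxDr mulmxA vP0.
  by rewrite mul0mx add0r.
exact: submx_trans (submxMr _ vfU) (Ust _).
Qed.

(** The span is stable under A, so once it contains v it contains every v A^e. Otherwise
    [krylov_mem] makes the d vectors v A^e independent modulo the span. Ranks thus grow in steps of
    d, as for dimensions over F[t]/(P). *)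
Lemma rank_krylovS A j (V : 'M[F]_(j, n.+1)) (v : 'rV_n.+1) :
    v *m horner_mx A P = 0 -> V *m horner_mx A P = 0 ->
  \rank (krylov d A (col_mx v V)) =
  (\rank (krylov d A V) + ~~ (v <= krylov d A V)%MS * d)%N.
Proof.
move=> vP0 VP0; rewrite krylov_col_mx addsmxC.
case: (boolP (v <= _)%MS) => [vV|nvV] /=.
  rewrite addn0; apply/eqmx_rank/eqmxP/addsmx_idPl/sub_krylov => e _.
  apply: submx_trans (submxMr _ vV) _.
  by rewrite -horner_mxXn; exact: krylov_stable.
(* Combinations of the rows of [D] are the images of v under polynomials of degree below d, to which
   [krylov_mem] applies. *)
pose D := \matrix_(e < d) (v *m A ^+ e).
have DE c : c *m D = v *m horner_mx A (rVpoly c).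
  rewrite (@horner_mx_sum _ _ d) ?size_poly // mulmx_sumr mulmx_sum_row.
  by apply: eq_bigr => e _; rewrite rowK -scalemxAr coef_rVpoly_ord.
have eqD : (krylov d A v :=: D)%MS.
  apply/eqmxP/andP; split.
    apply: sub_krylov => e lt_ed.
    by have := row_sub (Ordinal lt_ed) D; rewrite rowK.
  by apply/row_subP => e; rewrite rowK krylov_sup.
have D0 (c : 'rV_d) : (c *m D <= krylov d A V)%MS -> c = 0.
  move=> cV; apply/eqP; apply: contraNT nvV => c0.
  apply: (@krylov_mem A _ _ v (rVpoly c) vP0) => //; rewrite -?DE ?size_poly //.
    by move=> g; exact: krylov_stable.
  by apply: contra c0 => /eqP c0; rewrite -(rVpolyK c) c0 linear0.
have Dfree : row_free D.
  by apply: inj_row_free => c cD0; apply: D0; rewrite cD0 sub0mx.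
have dir : (krylov d A V :&: krylov d A v = 0)%MS.
  apply/eqP/rowV0P => u; rewrite sub_capmx eqD => /andP[uV /submxP[c cE]].
  by move: uV; rewrite cE => /D0->; rewrite mul0mx.
rewrite (mxrank_disjoint_sum dir) eqD mul1n.
by move: Dfree => /eqP ->.
Qed.

End Krylov.

(** * Counting independent tuples in ker P(A) *)

Section KrylovCount.
Variables (F : finFieldType) (n : nat) (P : {poly F}) (d : nat).
Hypotheses (sizeP : size P = d.+1) (P_irr : irreducible_poly P).
Implicit Types A : 'M[F]_n.+1.

Let d_gt0 : (0 < d)%N.
Proof. by case: P_irr; rewrite sizeP. Qed.

(** Maximal rank of the Krylov family expresses linear independence of the rows of [V] over
    F[t]/(P). *)
Definition krylov_free A j : {set 'M[F]_(j, n.+1)} :=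
  [set V | (V *m horner_mx A P == 0) && (\rank (krylov d A V) == d * j)%N].

Lemma rank_krylov_le A j (V : 'M[F]_(j, n.+1)) :
  (\rank (krylov d A V) <= d * j)%N.
Proof.
by apply: leq_trans (rank_leq_row _) _; rewrite sum_nat_const card_ord.
Qed.

Lemma card_submx m (U : 'M[F]_(m, n.+1)) :
  #|[set v : 'rV[F]_n.+1 | (v <= U)%MS]%SET| = (#|F| ^ \rank U)%N.
Proof. by rewrite -card_rowg; apply: eq_card => v; rewrite !inE. Qed.

Lemma krylov_freeS A j (v : 'rV[F]_n.+1) (V : 'M[F]_(j, n.+1)) :
  (col_mx v V \in krylov_free A (1 + j)) =
  [&& V \in krylov_free A j, (v <= kermx (horner_mx A P))%MS
    & ~~ (v <= krylov d A V)%MS].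
Proof.
rewrite !inE mul_col_mx col_mx_eq0 sub_kermx.
have [vP0|] := eqVneq (v *m _) 0; last by rewrite andbF.
have [VP0|//] := eqVneq (V *m _) 0.
rewrite (rank_krylovS sizeP P_irr vP0 VP0) /= mulnDr muln1 addnC.
case: (boolP (v <= _)%MS) => _ /=.
  rewrite mul0n add0n !andbF; apply/negbTE.
  by rewrite neq_ltn (leq_ltn_trans (rank_krylov_le A V)) // -addn1 addnC leq_add2r.
by rewrite mul1n eqn_add2l !andbT.
Qed.

(** The new row ranges over the kernel of P(A) minus the Krylov span of [V], which lies in that
    kernel and has q^(dj) elements. *)
Lemma card_krylov_freeS A j :
  (#|krylov_free A (1 + j)| = #|krylov_free A j| *
    (#|F| ^ \rank (kermx (horner_mx A P)) - #|F| ^ (d * j)))%N.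
Proof.
pose N (V : 'M[F]_(j, n.+1)) : {set 'rV[F]_n.+1} :=
  [set v | (v <= kermx (horner_mx A P))%MS] :\: [set v | (v <= krylov d A V)%MS].
have cardN V : V \in krylov_free A j -> #|N V| =
    (#|F| ^ \rank (kermx (horner_mx A P)) - #|F| ^ (d * j))%N.
  rewrite inE => /andP[/eqP VP0 /eqP rV]; rewrite cardsD !card_submx -rV.
  congr (_ - _)%N; rewrite -card_submx; apply: eq_card => v; rewrite !inE.
  case: (boolP (v <= krylov _ _ _)%MS); last by rewrite andbF.
  move=> /submx_trans-> //; rewrite sub_kermx; apply/eqP.
  exact: krylov_annihilated.
rewrite -sum_nat_const -(eq_bigr _ cardN) -sum1_card.
under [RHS]eq_bigr do rewrite -sum1_card.
rewrite pair_big_dep /=.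
rewrite (reindex (fun vV : 'M[F]_(j, n.+1) * 'rV[F]_n.+1 => col_mx vV.2 vV.1)) /=.
  apply: eq_bigl => -[V v] /=; rewrite krylov_freeS; congr (_ && _).
  by rewrite !inE andbC.
exists (fun W => (dsubmx W, usubmx W)) => [[V v] _|W _] /=.
  by rewrite col_mxKd col_mxKu.
exact: vsubmxK.
Qed.

Lemma card_krylov_free (R : comNzRingType) A j :
  #|krylov_free A j|%:R =
  \prod_(i < j) (#|F|%:R ^+ \rank (kermx (horner_mx A P)) -
                 (#|F|%:R ^+ d) ^+ i) :> R.
Proof.
elim: j => [|j IHj].
  rewrite big_ord0 (_ : krylov_free A 0 = [set: 'M[F]_(0, n.+1)]%SET).
    by rewrite cardsT card_mx mul0n expn0.
  apply/setP => V; rewrite !inE (flatmx0 V) mul0mx eqxx /=.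
  by have := rank_krylov_le A (0 : 'M[F]_(0, n.+1)); rewrite muln0 leqn0.
rewrite big_ord_recr /= -IHj -exprM -!natrX -add1n card_krylov_freeS.
(* Subtraction of naturals is truncated. Without a free j-tuple both sides vanish; otherwise the
   span of such a tuple lies in the kernel and no truncation occurs. *)
have [->|[V]] := set_0Vmem (krylov_free A j); first by rewrite cards0 !mul0r.
rewrite inE => /andP[/eqP VP0 /eqP rV]; rewrite natrM natrB //.
rewrite leq_exp2l ?card_finNzRing_gt1 //.
rewrite -rV mxrankS // sub_kermx; apply/eqP; exact: krylov_annihilated.
Qed.

Lemma card_krylov_free_eq0 A j : (n.+1 < d * j)%N -> #|krylov_free A j| = 0%N.
Proof.
move=> lt_n; apply: eq_card0 => V; rewrite !inE; apply/negbTE.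
by rewrite negb_and neq_ltn (leq_ltn_trans (rank_leq_col _) lt_n) orbT.
Qed.

End KrylovCount.

(** Case P = X, A = 0 of [card_krylov_free]: the kernel is the whole space and the Krylov family of
    [W] spans the same rows as [W]. *)
Lemma card_row_free (F : finFieldType) n r (R : comNzRingType) :
  #|[pred W : 'M[F]_(r, n.+1) | row_free W]|%:R =
  \prod_(i < r) (#|F|%:R ^+ n.+1 - #|F|%:R ^+ i) :> R.
Proof.
have irrX : irreducible_poly ('X : {poly F}).
  by rewrite -['X]subr0; exact: irredp_XsubC.
have := card_krylov_free (size_polyX F) irrX R (0 : 'M[F]_n.+1) r.
rewrite horner_mx_X mxrank_ker mxrank0 subn0.
under eq_bigr do rewrite expr1.
move=> <-; congr (_%:R); apply: eq_card => W.
rewrite !inE horner_mx_X mulmx0 eqxx mul1n /=.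
have -> // : \rank (krylov 1 0 W) = \rank W.
apply: eqmx_rank; apply/andP; split.
  by apply: sub_krylov => -[|//] _; rewrite expr0 mulmx1.
by have := krylov_sup 0 W (ltn0Sn 0); rewrite expr0 mulmx1.
Qed.

(** A right inverse of [W] makes the map sending A to W A surjective, with fibers that are
    translates of one another. *)
Lemma card_mulmx_fiber (F : finFieldType) r n (W B : 'M[F]_(r, n)) :
  row_free W ->
  (#|[pred A : 'M[F]_n | W *m A == B]| * #|F| ^ (n * r) = #|F| ^ (n * n))%N.
Proof.
case/row_freeP => V WV1.
have fiberE (C : 'M[F]_(r, n)) :
    #|[pred A | W *m A == B]| = #|[pred A | W *m A == C]|.
  have inj := addrI (V *m (C - B)).
  rewrite -(fintype.card_image inj); apply: eq_card => A; rewrite [RHS]inE.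
  apply/fintype.imageP/eqP => [[A' + ->]|WAC].
    by rewrite inE => /eqP WA'; rewrite mulmxDr mulmxA WV1 mul1mx WA' subrK.
  exists (A - V *m (C - B)); last by rewrite addrC subrK.
  by rewrite inE mulmxBr mulmxA WV1 mul1mx WAC subKr.
have -> : (#|F| ^ (n * n))%N = #|{: 'M[F]_n}| by rewrite card_mx.
rewrite -[RHS]sum1_card (partition_big (mulmx W) xpredT) //=.
rewrite (eq_bigr (fun=> #|[pred A | W *m A == B]|)); last first.
  by move=> C _; rewrite (fiberE C) -sum1_card; apply: eq_bigl => A; rewrite inE.
by rewrite sum_nat_const card_mx mulnC (mulnC r).
Qed.

(** * Averaging the count over all A *)

Section KrylovSum.
Variables (F : finFieldType) (n : nat) (P : {poly F}) (d : nat).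
Hypotheses (sizeP : size P = d.+2) (P_monic : P \is monic).
Implicit Types A : 'M[F]_n.+1.
Local Notation krylov := (krylov d.+1).

(* The matrix C W, where C is the block companion matrix of P. *)
Definition companion_shift j (W : 'M[F]_(\sum_(e < d.+1) j, n.+1)) :
    'M[F]_(\sum_(e < d.+1) j, n.+1) :=
  \mxcol_(e < d.+1)
    if (e < d)%N then submxcol W (inord e.+1)
    else - \sum_(i < d.+1) P`_i *: submxcol W i.

Lemma horner_mx_monic A :
  horner_mx A P = \sum_(i < d.+1) P`_i *: A ^+ i + A ^+ d.+1.
Proof.
rewrite (@horner_mx_sum _ _ A P d.+2) ?sizeP // big_ord_recr /=; congr (_ + _).
by have /monicP := P_monic; rewrite lead_coefE sizeP /= => ->; rewrite scale1r.
Qed.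

Lemma mulmx_horner_eq0 A j (V : 'M[F]_(j, n.+1)) :
  (V *m horner_mx A P == 0) =
  (V *m A ^+ d.+1 == - \sum_(i < d.+1) P`_i *: (V *m A ^+ i)).
Proof.
rewrite horner_mx_monic mulmxDr addrC addr_eq0 mulmx_sumr.
by under eq_bigr do rewrite -scalemxAr.
Qed.

Lemma krylov_companion A j (V : 'M[F]_(j, n.+1)) : V *m horner_mx A P = 0 ->
  krylov A V *m A = companion_shift (krylov A V).
Proof.
move=> /eqP; rewrite mulmx_horner_eq0 => /eqP VA.
rewrite mxcol_mul; apply: eq_mxcol => e; rewrite -mulmxA mulmxE -exprSr.
case: ltnP => [lt_ed|le_de]; first by rewrite mxcolK inordK.
have -> : e = d :> nat by apply/eqP; rewrite eqn_leq le_de -ltnS ltn_ord.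
by rewrite VA; congr (- _); apply: eq_bigr => i _; rewrite mxcolK.
Qed.

(** Read block by block, all equations but the last force block e to be V A^e, where V is block 0;
    the last one then says V P(A) = 0. *)
Lemma companion_krylov A j (W : 'M[F]_(\sum_(e < d.+1) j, n.+1)) :
  W *m A = companion_shift W ->
  krylov A (submxcol W ord0) = W /\ submxcol W ord0 *m horner_mx A P = 0.
Proof.
move=> WA.
have WAe (e : 'I_d.+1) : submxcol W e *m A =
    if (e < d)%N then submxcol W (inord e.+1)
    else - \sum_(i < d.+1) P`_i *: submxcol W i.
  by rewrite submxcol_mul WA mxcolK.
have W0 e : (e < d.+1)%N -> submxcol W ord0 *m A ^+ e = submxcol W (inord e).
  elim: e => [|e IHe] lt_ed.
    by rewrite expr0 mulmx1; congr submxcol; apply: val_inj; rewrite /= inordK.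
  have lt_ed' := ltnW lt_ed.
  by rewrite exprSr -mulmxE mulmxA IHe // WAe inordK // (lt_ed : (e < d)%N).
split.
  by rewrite -[RHS]submxcolK; apply: eq_mxcol => e; rewrite W0 // inord_val.
apply/eqP; rewrite mulmx_horner_eq0 exprSr -mulmxE mulmxA W0 // WAe inordK // ltnn.
by apply/eqP; congr (- _); apply: eq_bigr => i _; rewrite W0 // inord_val.
Qed.

(** Passing from V to its Krylov family is injective, since block 0 is V, and [companion_krylov]
    identifies the image. *)
Lemma card_krylov_free_companion A j :
  #|krylov_free P d.+1 A j| =
  #|[pred W : 'M[F]_(\sum_(e < d.+1) j, n.+1) |
     row_free W & W *m A == companion_shift W]|.
Proof.
have inj : injective (fun V : 'M[F]_(j, n.+1) => krylov A V).
  move=> V V' /(congr1 (fun W => submxcol W ord0)).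
  by rewrite !mxcolK expr0 !mulmx1.
rewrite -(card_imset _ inj); apply: eq_card => W.
have freeE : row_free W = (\rank W == d.+1 * j)%N.
  by rewrite /row_free; congr (_ == _); rewrite sum_nat_const card_ord.
rewrite [RHS]inE; apply/imsetP/andP => [[V]|[Wfree /eqP WA]].
  rewrite inE => /andP[/eqP VP0 rV] WE; rewrite freeE WE rV.
  by rewrite krylov_companion.
have [WE WP0] := companion_krylov WA.
exists (submxcol W ord0); last by rewrite WE.
by rewrite inE WP0 eqxx WE -freeE.
Qed.

(** Double counting of the pairs (A, W): for a fixed row-free W, the condition that W A is the
    companion shift of W describes one fiber of [mulmx W], whose size does not depend on W. *)
Lemma sum_card_krylov_free j :
  ((\sum_(A : 'M[F]_n.+1) #|krylov_free P d.+1 A j|) * #|F| ^ (n.+1 * (d.+1 * j)) =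
   #|[pred W : 'M[F]_(d.+1 * j, n.+1) | row_free W]| * #|F| ^ (n.+1 * n.+1))%N.
Proof.
rewrite -[(d.+1 * j)%N](_ : (\sum_(e < d.+1) j)%N = _); last first.
  by rewrite sum_nat_const card_ord.
under eq_bigr do rewrite card_krylov_free_companion -sum1_card.
rewrite (exchange_big_dep
  (fun W : 'M[F]_(\sum_(e < d.+1) j, n.+1) => row_free W)) /=; last first.
  by move=> A W _ /andP[].
rewrite big_distrl /= -sum_nat_const; apply: eq_bigr => W Wfree.
rewrite -(card_mulmx_fiber (companion_shift W) Wfree); congr (_ * _)%N.
by rewrite -sum1_card; apply: eq_bigl => A; rewrite !inE Wfree.
Qed.

End KrylovSum.

(* Gaussian binomial inversion: the summand at [x = Q ^+ r] is
   (-1)^j Q^(j(j-1)/2) times the Gaussian binomial coefficient [r choose j]. *)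
Lemma sum_gauss_alternating (K : fieldType) (Q x : K) J :
  (forall i, Q ^+ i.+1 != 1) ->
  \sum_(j < J.+1) \prod_(i < j) ((Q ^+ i - x) / (Q ^+ i.+1 - 1)) =
  \prod_(i < J) ((Q ^+ i.+1 - x) / (Q ^+ i.+1 - 1)).
Proof.
move=> Q1; elim: J => [|J IHJ]; first by rewrite big_ord1 !big_ord0.
rewrite big_ord_recr {}IHJ /= [in RHS]big_ord_recr /= !prodf_div.
(* Splitting off the factor i = 0 exposes the numerator shared with the induction hypothesis. *)
rewrite [X in _ + X / _](_ : _ = (1 - x) * \prod_(i < J) (Q ^+ i.+1 - x)).
  rewrite [X in _ + _ / X]big_ord_recr /=.
  have := Q1 J; rewrite -subr_eq0 => QJ.
  have D0 : \prod_(i < J) (Q ^+ i.+1 - 1) != 0.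
    by apply/prodf_neq0 => i _; rewrite subr_eq0.
  by field; rewrite QJ D0.
by rewrite big_ord_recl.
Qed.

(** * Proportion of A with P(A) invertible over a finite field *)

Section InvertibleCount.
Variables (F : finFieldType) (n : nat) (P : {poly F}) (d : nat).
Hypotheses (sizeP : size P = d.+2) (P_monic : P \is monic).
Hypothesis P_irr : irreducible_poly P.
Variable R : numFieldType.
Local Notation q := (#|F|%:R : R).
Local Notation Q := (q ^+ d.+1).

Let q_gt1 : 1 < q.
Proof. by rewrite ltr1n card_finNzRing_gt1. Qed.

Let Q_neq1 i : Q ^+ i.+1 != 1.
Proof. by rewrite gt_eqF // -exprM exprn_egt1. Qed.

(** Inversion at x = q^r, with r the dimension of the kernel, collapses the sum to the product of
    (Q^i - q^r) / (Q^i - 1) over 1 <= i <= J. It is 1 for r = 0 and 0 when q^r is one of Q, ...,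
    Q^J. *)
Lemma horner_mx_unit_indicator J (A : 'M[F]_n.+1) : (n < J)%N ->
  (horner_mx A P \in unitmx)%:R =
  \sum_(j < J.+1) (\prod_(i < j) (- (Q ^+ i.+1 - 1)^-1)) *
    #|krylov_free P d.+1 A j|%:R.
Proof.
move=> lt_nJ; pose r := \rank (kermx (horner_mx A P)).
have cardE := card_krylov_free sizeP P_irr R A.
under eq_bigr => j _.
  rewrite cardE -big_split /=.
  under eq_bigr do rewrite mulNr -mulrN opprB mulrC.
  over.
rewrite sum_gauss_alternating //.
(* No free (J+1)-tuple fits into dimension n+1. The vanishing of its counting formula forces q^r =
   Q^i for some i <= J. *)
have : \prod_(i < J.+1) (q ^+ r - Q ^+ i) = 0.
  rewrite -cardE card_krylov_free_eq0 //.
  by rewrite mulSn ltn_addr.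
have unitE : (horner_mx A P \in unitmx) = (r == 0%N).
  by rewrite -row_free_unit -kermx_eq0 -mxrank_eq0.
move/eqP/prodf_eq0 => [i _]; rewrite subr_eq0 -exprM.
have q0 : 0 < q by exact: lt_trans ltr01 q_gt1.
have q1 : q != 1 by rewrite gt_eqF.
rewrite (inj_eq (ieexprIn q0 q1)) unitE -/r => /eqP rE.
rewrite rE muln_eq0 /= exprM; case: i {rE} => -[|i] lt_i /=.
  by rewrite big1 // => i _; rewrite expr0 divff // subr_eq0.
apply/esym/eqP/prodf_eq0; exists (Ordinal (lt_i : (i < J)%N)) => //=.
by rewrite subrr mul0r.
Qed.

(** By [sum_card_krylov_free], the mean number of free j-tuples is the proportion of row-free
    matrices with deg(P) j rows, hence the inner product. *)
Lemma prob_horner_mx_unit J : (n < J)%N ->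
  #|[pred A : 'M[F]_n.+1 | horner_mx A P \in unitmx]|%:R / q ^+ (n.+1 * n.+1) =
  \sum_(j < J.+1) (\prod_(i < j) (- (Q ^+ i.+1 - 1)^-1)) *
    \prod_(i < d.+1 * j) (1 - q ^+ i / q ^+ n.+1).
Proof.
move=> lt_nJ.
have qn0 k : q ^+ k != 0 by rewrite expf_neq0 // gt_eqF // (lt_trans ltr01).
rewrite -sum1_card natr_sum big_mkcond /=.
rewrite (eq_bigr (fun A : 'M[F]_n.+1 => (horner_mx A P \in unitmx)%:R)); last first.
  by move=> A _; rewrite inE; case: ifP.
under eq_bigr do rewrite (horner_mx_unit_indicator _ lt_nJ).
rewrite exchange_big /= mulr_suml; apply: eq_bigr => j _.
rewrite -mulr_sumr -mulrA; congr (_ * _); rewrite -natr_sum.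
apply: (mulIf (qn0 (n.+1 * (d.+1 * j))%N)).
rewrite mulrAC -[X in _ * X / _]natrX -natrM.
rewrite (sum_card_krylov_free n sizeP P_monic) natrM natrX mulfK //.
rewrite card_row_free exprM -[X in _ * _ ^+ X](card_ord (d.+1 * j)).
rewrite -prodr_const -big_split /=.
by apply: eq_bigr => i _; rewrite mulrBl mul1r divfK.
Qed.

End InvertibleCount.

(** * Reduction modulo the maximal ideal *)

(** A non-unit x outside m would lie in an ideal M maximal among the proper ideals containing x.
    Such an M is prime, and nonzero because x is, hence equal to m: a contradiction. *)
Lemma dvr_unit (O : idomainType) (m : set O) (x : O) :
  is_dvr m -> ~ m x -> x \is a GRing.unit.
Proof.
move=> [_ [[m0 _] _ _] _ uniq_m] nmx; apply/negPn/negP => xnu.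
pose proper_over (I : set O) := [/\ is_ideal I, ~ I 1 & I x].
have [|M [[M0|[idM M1 Mx]] maxM]] :=
    @Zorn_bigcup O (fun I => I = set0 \/ proper_over I).
- move=> C Csub Ctot.
  have [[I CI [y Iy]]|C0] := pselect (exists2 I, C I & I !=set0); last first.
    left; rewrite -subset0 => y [I CI Iy]; apply: C0.
    by exists I => //; exists y.
  have propC J z : C J -> J z -> proper_over J.
    by move=> CJ Jz; have [J0|//] := Csub _ CJ; rewrite J0 in Jz.
  have [[I0 _] _ Ix] := propC _ _ CI Iy.
  right; split; last by exists I.
    split=> [|a u v [J CJ Ju] [K CK Kv]]; first by exists I.
    have [[_ lJ] _ _] := propC _ _ CJ Ju; have [[_ lK] _ _] := propC _ _ CK Kv.
    have [JK|KJ] := Ctot _ _ CJ CK.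
      by exists K => //; apply: lK => //; apply: JK.
    by exists J => //; apply: lJ => //; apply: KJ.
  by move=> [J CJ J1]; have [_ + _] := propC _ _ CJ J1; apply.
- apply: (maxM (range (fun y => y * x))).
    rewrite M0; split=> // /(_ (1 * x)); apply; exact: imageT.
  right; split.
  + split; first by exists 0; rewrite ?mul0r.
    move=> a _ _ [u _ <-] [v _ <-]; exists (a * u + v) => //.
    by rewrite mulrDl mulrA.
  + by move=> [u _ ux]; move/unitrPr: xnu; apply; exists u; rewrite mulrC.
  + by exists 1; rewrite ?mul1r.
- have [M0 lM] := idM.
  suff prM : is_prime_ideal M.
    apply: (nmx); rewrite -(uniq_m M prM) // => ME; move: Mx; rewrite ME /= => x0.
    by apply: nmx; rewrite x0.
  split=> // a b Mab; apply: contrapT => /not_orP[nMa nMb].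
  (* The ideal generated by M and a. *)
  pose J := [set z | exists2 u, M u & exists s, z = s * a + u].
  have MJ : M `<=` J by move=> u Mu; exists u => //; exists 0; rewrite mul0r add0r.
  apply: (maxM J).
    split=> // JM; apply: nMa; apply: JM; exists 0 => //.
    by exists 1; rewrite mul1r addr0.
  right; split; [split|move=> [u Mu [s E]]|exact: MJ]; first exact: MJ.
    move=> c _ _ [u Mu [s ->]] [v Mv [t ->]]; exists (c * u + v); first exact: lM.
    by exists (c * s + t); ring.
  (* From 1 = s a + u with u in M, the element b = s (a b) + b u lies in M. *)
  apply: nMb; rewrite -[b]mulr1 E.
  rewrite (_ : _ * _ = s * (a * b) + (b * u + 0)); last by ring.
  by apply: (lM) => //; apply: (lM).
Qed.

(** A zero cokernel means surjectivity; preimages of the unit vectors form a right inverse, which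
    over a commutative ring is two-sided. *)
Lemma coker_eq0P (O : comUnitRingType) n (B : 'M[O]_n) :
  coker_eq0 B <-> B \in unitmx.
Proof.
split=> [B0|uB].
  have im v : v \in im_mx B.
    by rewrite -[v]subr0 Quotient.idealrBE; apply/eqP; rewrite [LHS]B0 [RHS]B0.
  pose C := \matrix_(i, j) xget 0 [set w : 'cV[O]_n | B *m w = col j 1%:M] i 0.
  have BC1 : B *m C = 1%:M.
    apply/matrixP => i j; have /asboolP[w Bw] := im (col j 1%:M).
    have /= := xgetPex 0 (ex_intro [set w : 'cV[O]_n | B *m w = col j 1%:M] w Bw).
    move=> /matrixP/(_ i 0); rewrite !mxE => <-; apply: eq_bigr => l _.
    by rewrite !mxE.
  by have [] := mulmx1_unit BC1.
elim/quotW => v; have <- : (\pi_(coker B) 0)%qT = 0 by rewrite piE.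
apply/eqP; rewrite -Quotient.idealrBE subr0; apply/asboolP.
by exists (invmx B *m v); rewrite mulmxA mulmxV // mul1mx.
Qed.

Section Reduction.
Variables (O : idomainType) (m : set O) (k : finFieldType).
Variable rho : {rmorphism O -> k}.
Hypothesis rho_surj : forall y : k, exists x : O, rho x = y.
Hypothesis rho_ker : forall x : O, rho x = 0 <-> m x.

Lemma map_mx_surj n (B : 'M[k]_n) : exists A : 'M[O]_n, map_mx rho A = B.
Proof.
exists (\matrix_(i, j) xget 0 [set x | rho x = B i j]).
apply/matrixP => i j; rewrite !mxE.
exact: (@xgetPex _ 0 [set x | rho x = B i j] (rho_surj _)).
Qed.

Lemma unit_rho x : is_dvr m -> (x \is a GRing.unit) = (rho x != 0).
Proof.
move=> dvr; apply/idP/idP => [/(rmorph_unit rho)|/eqP rx0].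
  by rewrite unitfE.
by apply: (dvr_unit dvr) => /rho_ker.
Qed.

Lemma unitmx_rho n (B : 'M[O]_n) : is_dvr m ->
  (B \in unitmx) = (map_mx rho B \in unitmx).
Proof. by move=> dvr; rewrite !unitmxE det_map_mx unit_rho // unitfE. Qed.

Lemma map_poly_mx n (P : {poly O}) (A : 'M[O]_n.+1) :
  map_mx rho (poly_mx P A) = horner_mx (map_mx rho A) (map_poly rho P).
Proof. by rewrite poly_mxE map_horner_mx. Qed.

Hypothesis m_ideal : is_ideal m.

Lemma ideal_pow1_sub : ideal_pow m 1 `<=` m.
Proof.
by move=> x; apply; split=> // _ [f mf <-]; rewrite big_ord1; exact: mf.
Qed.

Lemma nbhs_residue (x : adic m) : nbhs x [set y : adic m | rho y = rho x].
Proof.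
rewrite -nbhs_entourageE; exists [set xy | rho xy.1 = rho xy.2].
  exists 1%N => // -[y z] /= /ideal_pow1_sub/rho_ker.
  by rewrite rmorphB => /eqP; rewrite subr_eq0 => /eqP.
by move=> y /xsectionP.
Qed.

(** Residue classes of entries are open, so the set is open in the product topology. *)
Lemma measurable_residue n (S : pred 'M[k]_n) :
  measurable ([set A : 'M[O]_n | S (map_mx rho A)] : set (borel_mx m n)).
Proof.
apply: sub_sigma_algebra; rewrite /= openE => A SA.
exists (fun i j => [set y : adic m | rho y = rho (A i j)]) => [i j|B BA] /=.
  exact: nbhs_residue.
rewrite (_ : map_mx rho B = map_mx rho A) //.
by apply/matrixP => i j; rewrite !mxE; exact: BA.
Qed.

Lemma measurable_residue1 n (B : 'M[k]_n) :
  measurable ([set A : 'M[O]_n | map_mx rho A = B] : set (borel_mx m n)).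
Proof.
rewrite (_ : [set A : 'M[O]_n | _] = [set A : 'M[O]_n | pred1 B (map_mx rho A)]).
  exact: measurable_residue.
by apply/seteqP; split=> A /= /eqP.
Qed.

Variables (R : realType) (n : nat) (mu : probability (borel_mx m n) R).
Hypothesis mu_haar : is_haar mu.

(** A lift of B translates the class of 0 onto the class of B. *)
Lemma haar_residue_class (B : 'M[k]_n) :
  mu [set A : 'M[O]_n | map_mx rho A = B] = mu [set A : 'M[O]_n | map_mx rho A = 0].
Proof.
have [M MB] := map_mx_surj B.
rewrite -[RHS](mu_haar M); last exact: measurable_residue1.
congr (mu _); apply/seteqP; split=> [A /= AB|_ [A /= A0 <-]].
  by exists (A - M); rewrite ?map_mxB ?AB ?MB ?subrr // addrC subrK.
by rewrite /= map_mxD A0 addr0.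
Qed.

(** All residue classes have the same mass c; finite additivity gives #|S| c, and total mass 1
    determines c. *)
Lemma haar_residue (S : pred 'M[k]_n) :
  mu [set A : 'M[O]_n | S (map_mx rho A)] =
  (#|S|%:R / #|k|%:R ^+ (n * n))%:E.
Proof.
set c := fine (mu [set A : 'M[O]_n | map_mx rho A = 0]).
have mu1 (B : 'M[k]_n) : mu [set A : 'M[O]_n | map_mx rho A = B] = c%:E.
  rewrite haar_residue_class fineK // fin_num_measure //.
  exact: measurable_residue1.
have muE (T : pred 'M[k]_n) :
    mu [set A : 'M[O]_n | T (map_mx rho A)] = (#|T|%:R * c)%:E.
  have -> : [set A : 'M[O]_n | T (map_mx rho A)] =
            [set A : 'M[O]_n | map_mx rho A \in enum T].
    by apply/seteqP; split=> A /=; rewrite mem_enum.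
  rewrite cardE; elim: (enum T) (enum_uniq T) => [_|B s IHs /= /andP[Bs us]].
    rewrite mul0r (_ : [set A : 'M[O]_n | _] = set0) ?measure0 //.
    by apply/seteqP; split=> A.
  have -> : [set A : 'M[O]_n | map_mx rho A \in B :: s] =
      [set A : 'M[O]_n | map_mx rho A = B] `|`
      [set A : 'M[O]_n | map_mx rho A \in s].
    apply/seteqP; split=> A /=; first by move=> /predU1P[]; [left|right].
    by case=> [->|As]; rewrite in_cons ?eqxx // As orbT.
  rewrite measureU; last first.
  - by apply/seteqP; split=> // A /= [AB As]; rewrite -AB As in Bs.
  - exact: (measurable_residue (mem s)).
  - exact: measurable_residue1.
  by rewrite [X in (X + _)%E]mu1 [X in (_ + X)%E]IHs // -EFinD mulrS mulrDl mul1r.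
have := muE predT; rewrite (_ : [set A : 'M[O]_n | predT _] = setT); last first.
  exact/seteqP.
rewrite probability_setT muE => -[].
have -> : #|predT : pred 'M[k]_n| = (#|k| ^ (n * n))%N.
  by rewrite -card_mx; apply: eq_card.
rewrite natrX => c1.
have qn0 : #|k|%:R ^+ (n * n) != 0 :> R.
  by apply: contraPneq c1 => ->; rewrite mul0r; apply/eqP; rewrite oner_eq0.
by congr EFin; apply: (mulIf qn0); rewrite divfK // -mulrA [c * _]mulrC -c1 mulr1.
Qed.

End Reduction.

(** * Power series and Euler products *)

Section PowerSeriesMonoid.
Variable F : fieldType.
Implicit Types (f g h : nat -> F) (a b : {poly F}).

(** Coefficients up to m only involve truncations, so the ring laws of {poly F} carry over to power
    series. *)
Lemma fps_mul_coef f g a b m n : (n <= m)%N ->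
  (forall i, (i <= m)%N -> f i = a`_i) -> (forall i, (i <= m)%N -> g i = b`_i) ->
  fps_mul f g n = (a * b)`_n.
Proof.
move=> le_nm fa gb; rewrite coefM; apply: eq_bigr => i _.
by rewrite fa ?gb ?(leq_trans (leq_subr _ _)) // (leq_trans _ le_nm) // -ltnS.
Qed.

Lemma fps_truncE f m i : (i <= m)%N -> f i = (\poly_(j < m.+1) f j)`_i.
Proof. by move=> le_im; rewrite coef_poly ltnS le_im. Qed.

Lemma fps_mulA : associative (@fps_mul F).
Proof.
move=> f g h; apply/funext => n; pose t := fun f => \poly_(j < n.+1) f j : {poly F}.
have tE f' i : (i <= n)%N -> f' i = (t f')`_i by exact: fps_truncE.
have tM f1 f2 i : (i <= n)%N -> fps_mul f1 f2 i = (t f1 * t f2)`_i.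
  by move=> le_in; apply: fps_mul_coef le_in (tE _) (tE _).
rewrite (fps_mul_coef (leqnn n) (tE f) (tM g h)).
by rewrite (fps_mul_coef (leqnn n) (tM f g) (tE h)) mulrA.
Qed.

Lemma fps_mulC : commutative (@fps_mul F).
Proof.
move=> f g; apply/funext => n.
have fE := fps_truncE f (m := n); have gE := fps_truncE g (m := n).
by rewrite (fps_mul_coef (leqnn n) fE gE) mulrC -(fps_mul_coef (leqnn n) gE fE).
Qed.

Lemma fps_mul1f : left_id (@fps_one F) (@fps_mul F).
Proof.
move=> f; apply/funext => n; rewrite /fps_mul big_ord_recl /fps_one /= subn0 mul1r.
by rewrite big1 ?addr0 // => i _; rewrite mul0r.
Qed.

HB.instance Definition _ := Monoid.isComLaw.Build (nat -> F) (@fps_one F)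
  (@fps_mul F) fps_mulA fps_mulC fps_mul1f.

Lemma fps_of_polyM a b :
  fps_of_poly (a * b) = fps_mul (fps_of_poly a) (fps_of_poly b).
Proof. by apply/funext => n; rewrite /fps_of_poly coefM. Qed.

Lemma fps_of_poly1 : fps_of_poly (1 : {poly F}) = @fps_one F.
Proof. by apply/funext => n; rewrite /fps_of_poly coef1. Qed.

Lemma fps_of_poly_prod N (a : 'I_N -> {poly F}) :
  \big[@fps_mul F/@fps_one F]_(i < N) fps_of_poly (a i) =
  fps_of_poly (\prod_(i < N) a i).
Proof. by rewrite (big_morph _ fps_of_polyM fps_of_poly1). Qed.

Lemma fps_mulZXn (c : F) e g n :
  fps_mul (fps_of_poly (c *: 'X^e)) g n =
  if (e <= n)%N then c * g (n - e)%N else 0.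
Proof.
rewrite /fps_mul /fps_of_poly.
under eq_bigr do rewrite coefZ coefXn.
case: leqP => [le_en|lt_ne].
  rewrite (bigD1 (inord e)) //= inordK ?ltnS // eqxx mulr1 big1 ?addr0 // => i.
  rewrite -val_eqE /= inordK ?ltnS // => /negbTE ->.
  by rewrite mulr0 mul0r.
rewrite big1 // => i _; rewrite ltn_eqF ?mulr0 ?mul0r //.
by apply: leq_ltn_trans lt_ne; rewrite -ltnS.
Qed.

Lemma fps_mul_suml N (a : 'I_N -> {poly F}) g n :
  fps_mul (fps_of_poly (\sum_(i < N) a i)) g n =
  \sum_(i < N) fps_mul (fps_of_poly (a i)) g n.
Proof.
rewrite /fps_mul exchange_big /=; apply: eq_bigr => i _.
by rewrite /fps_of_poly coef_sum mulr_suml.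
Qed.

Lemma fps_mul_1sub (c : F) g n :
  fps_mul (fps_of_poly (1 - c *: 'X)) g n =
  g n - (if n is n'.+1 then c * g n' else 0).
Proof.
rewrite (_ : 1 - c *: 'X = \sum_(i < 2) [:: 1; - c]`_i *: 'X^i); last first.
  by rewrite big_ord_recl big_ord1 /= expr0 expr1 scale1r scaleNr.
rewrite fps_mul_suml big_ord_recl big_ord1 !fps_mulZXn /= mul1r subn0.
by case: n => [|n]; rewrite /= ?oppr0 // subn1 mulNr.
Qed.

Lemma fps_mul_inv_uniq f g h :
  fps_mul f g = @fps_one F -> fps_mul f h = @fps_one F -> g = h.
Proof.
move=> fg fh; rewrite -[g]fps_mul1f -fh -fps_mulA fps_mulC -fps_mulA.
by rewrite (fps_mulC g) fg fps_mulC fps_mul1f.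
Qed.

End PowerSeriesMonoid.

Section EulerProducts.
Variable F : fieldType.

(* Coefficients of U^j in prod_(1 <= i <= N) (1 - P^i U) and of u^n in
   prod_(0 <= i < N) (1 - p^i u)^-1, given by the q-binomial theorem. *)
Definition euler_num (P : F) N j : F :=
  \prod_(i < j) ((P ^+ N.+1 - P ^+ i.+1) / (1 - P ^+ i.+1)).
Definition euler_den (p : F) N n : F :=
  \prod_(i < n) ((1 - p ^+ (N + i)) / (1 - p ^+ i.+1)).

Lemma euler_num_eq0 P N j : (N < j)%N -> euler_num P N j = 0.
Proof.
move=> lt_Nj; apply/eqP/prodf_eq0; exists (Ordinal lt_Nj) => //=.
by rewrite subrr mul0r.
Qed.

Variable p : F.
Hypothesis p_neq1 : forall i, p ^+ i.+1 != 1.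

Let p1 i : 1 - p ^+ i.+1 != 0.
Proof. by rewrite subr_eq0 eq_sym. Qed.

Let D0 j : \prod_(i < j) (1 - p ^+ i.+1) != 0.
Proof. by apply/prodf_neq0 => i _; exact: p1. Qed.

(** Comparison of coefficients when the factor 1 - p^(N+1) U is appended: a form of the q-Pascal
    rule. *)
Lemma euler_numS N j :
  euler_num p N.+1 j.+1 = euler_num p N j.+1 - p ^+ N.+1 * euler_num p N j.
Proof.
rewrite /euler_num !prodf_div.
rewrite [X in X / _ = _](_ : _ = (p ^+ N.+2 - p) *
    (p ^+ j * \prod_(i < j) (p ^+ N.+1 - p ^+ i.+1))); last first.
  rewrite big_ord_recl expr1 -[in X in _ * (p ^+ X * _)](card_ord j).
  rewrite -prodr_const -big_split /=; congr (_ * _).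
  by apply: eq_bigr => i _; rewrite mulrBr -!exprS.
rewrite !big_ord_recr /=; move: (D0 j) (p1 j).
move: (\prod_(i < j) _) (\prod_(i < j) _) => D S D0j; rewrite !exprS => p1j.
by field; rewrite D0j.
Qed.

(** The algebra is arbitrary because Y is specialized both to 'X^d and to the scalar 1. *)
Lemma prod_euler_num (A : comAlgType F) N (Y : A) :
  \prod_(i < N) (1 - p ^+ i.+1 *: Y) = \sum_(j < N.+1) euler_num p N j *: Y ^+ j.
Proof.
elim: N => [|N IHN]; first by rewrite big_ord1 big_ord0 /euler_num big_ord0 scale1r.
rewrite big_ord_recr /= {}IHN mulrBr mulr1 -scalerAr mulr_suml.
rewrite [RHS]big_ord_recl /=.
under [in RHS]eq_bigr do rewrite /bump /= add1n euler_numS scalerBl.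
rewrite big_split /= addrA; congr (_ + _).
  rewrite [in RHS]big_ord_recr /= (euler_num_eq0 _ (ltnSn N)) scale0r addr0.
  by rewrite big_ord_recl /=; congr (_ + _); rewrite /euler_num !big_ord0.
rewrite sumrN scaler_sumr; congr (- _); apply: eq_bigr => j _.
by rewrite -scalerAl scalerA -exprSr.
Qed.

(** Comparison of coefficients when multiplication by 1 - p^N u cancels the last inverse factor. *)
Lemma euler_denS N n :
  euler_den p N.+1 n.+1 - p ^+ N * euler_den p N.+1 n = euler_den p N n.+1.
Proof.
rewrite /euler_den !prodf_div.
rewrite [X in _ = X / _]big_ord_recl addn0 /=.
under [X in _ = _ * X / _]eq_bigr do rewrite /bump /= addnCA add1n -addSn.
rewrite !big_ord_recr /=; move: (D0 n) (p1 n).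
move: (\prod_(i < n) _) (\prod_(i < n) _) => S D D0n.
rewrite addSn !exprS exprD => p1n.
by field; rewrite D0n p1n.
Qed.

Lemma fps_mul_euler_den N :
  fps_mul (fps_of_poly (\prod_(i < N) (1 - p ^+ i *: 'X))) (euler_den p N) =
  @fps_one F.
Proof.
elim: N => [|N IHN].
  rewrite big_ord0 fps_of_poly1 fps_mul1f; apply/funext => -[|n].
    by rewrite /euler_den big_ord0.
  by rewrite /euler_den big_ord_recl expr0 subrr !mul0r.
rewrite big_ord_recr /= fps_of_polyM -fps_mulA -[RHS]IHN; congr fps_mul.
apply/funext => -[|n]; rewrite fps_mul_1sub; last exact: euler_denS.
by rewrite subr0 /euler_den !big_ord0.
Qed.

End EulerProducts.

Section PartialProducts.
Variables (R : realType) (q d : nat).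
Hypothesis q_gt1 : (1 < q)%N.
Local Notation p := (q%:R^-1 : R).

Lemma bfactorS i : bfactor R q d i.+1 =
  fps_mul (fps_of_poly (1 - (p ^+ d) ^+ i.+1 *: 'X^d))
          (fps_inv (fps_of_poly (1 - p ^+ i *: 'X))).
Proof.
rewrite /bfactor /fps_div exprZn -exprVn -!exprM mulnC.
have -> // : 1 - i.+1%:Z = - i%:Z by lia.
by rewrite -invr_expz -exprnP !exprVn.
Qed.

Lemma invn_exp_neq1 i : p ^+ i.+1 != 1.
Proof.
by rewrite lt_eqF // exprn_ilt1 ?invr_ge0 // invf_lt1 ?ltr1n // ltr0n ltnW.
Qed.

Lemma bprodE (d_gt0 : (0 < d)%N) N n :
  (\big[@fps_mul R/@fps_one R]_(1 <= i < N.+1) bfactor R q d i) n =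
  \sum_(j < N.+1) euler_num (p ^+ d) N j *
    if (d * j <= n)%N then euler_den p N (n - d * j) else 0.
Proof.
rewrite big_add1 big_mkord.
under eq_bigr do rewrite bfactorS.
rewrite big_split /= fps_of_poly_prod.
have p1 i : (p ^+ d) ^+ i.+1 != 1.
  by rewrite -exprM; case: d d_gt0 => // d' _; rewrite mulSn addSn invn_exp_neq1.
rewrite (prod_euler_num p1).
(* The product of inverses and the explicit series are both inverse to the same polynomial. *)
rewrite [X in fps_mul _ X](_ : _ = euler_den p N); last first.
  apply: (fps_mul_inv_uniq _ (fps_mul_euler_den invn_exp_neq1 N)).
  rewrite -fps_of_poly_prod -big_split /= big1 // => i _.
  apply: fps_mulV; rewrite /fps_of_poly coefB coef1 coefZ coefX.
  by rewrite mulr0 subr0 oner_neq0.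
rewrite fps_mul_suml; apply: eq_bigr => j _.
by rewrite -exprM fps_mulZXn; case: ifP => // _; rewrite mulr0.
Qed.

End PartialProducts.

(** * Limits *)

Section Tannery.
Variable R : realType.

Lemma cvg_sum_ord J (u : nat -> R^nat) (l : R^nat) :
  (forall j, u j @ \oo --> l j) ->
  (fun n => \sum_(j < J) u j n) @ \oo --> \sum_(j < J) l j.
Proof.
move=> ul; elim: J => [|J IHJ].
  by rewrite big_ord0; under eq_fun do rewrite big_ord0; exact: cvg_cst.
by rewrite big_ord_recr; under eq_fun do rewrite big_ord_recr; exact: cvgD.
Qed.

Lemma cvg_prod_ord J (u : nat -> R^nat) (l : R^nat) :
  (forall j, u j @ \oo --> l j) ->
  (fun n => \prod_(j < J) u j n) @ \oo --> \prod_(j < J) l j.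
Proof.
move=> ul; elim: J => [|J IHJ].
  by rewrite big_ord0; under eq_fun do rewrite big_ord0; exact: cvg_cst.
by rewrite big_ord_recr; under eq_fun do rewrite big_ord_recr; exact: cvgM.
Qed.

(** Beyond a fixed K both the terms and their limits are dominated by the tail of B; below K
    finitely many terms converge. *)
Lemma tannery (a : nat -> R^nat) (l B : R^nat) :
  (forall n j, `|a j n| <= B j) -> cvgn (series B) ->
  (forall j, a j @ \oo --> l j) ->
  (fun n => \sum_(j < n.+1) a j n) @ \oo --> limn (series l).
Proof.
move=> aB cB al.
have B0 j : 0 <= B j by apply: le_trans (aB 0%N j).
have lB j : `|l j| <= B j.
  have cal : (fun n => `|a j n|) @ \oo --> `|l j| by exact: cvg_norm (al j).
  rewrite -(cvg_lim _ cal) //; apply: limr_le; first exact: cvgP cal.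
  exact: nearW.
have cl : cvgn (series l).
  by apply: normed_cvg; apply: series_le_cvg lB cB => // n.
apply: (@cvg_sub0 _ _ _ _ _ _ (fun n => series l n.+1)); last first.
  by rewrite (cvg_shiftS (series l)).
apply/cvgr0Pnorm_lt => e e0.
(* One quarter is spent on the head and two on the tail, for the terms and for their limits. *)
have e4 : 0 < e / 4 by rewrite divr_gt0.
have /cvgrPdist_lt/(_ _ e4)[K _ KB] := cB.
have tail m : (K <= m)%N -> \sum_(K <= j < m) B j <= e / 4.
  move=> Km; rewrite -(sub_series_geq B Km).
  have := KB K (leqnn K); move/ltW; apply: le_trans.
  apply: le_trans (ler_norm _); rewrite lerD2r.
  apply: nondecreasing_cvgn_le cB _; apply/nondecreasing_seqP => n.
  by rewrite /series /= big_nat_recr //= lerDl.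
have cK : (fun n => \sum_(j < K) (`|a j n - l j|)) @ \oo --> \sum_(j < K) (0 : R).
  apply: (@cvg_sum_ord K (fun j n => `|a j n - l j|) (fun=> 0)) => j.
  exact/norm_cvg0P/subr_cvg0.
have {cK} cK : (fun n => \sum_(j < K) (`|a j n - l j|)) @ \oo --> (0 : R).
  by rewrite big1 in cK.
near=> n.
have Kn : (K <= n.+1)%N by near: n; exists K => // n /= /leqW.
rewrite fctE /= -(big_mkord xpredT (fun j => a j n)) /series /=.
rewrite -sumrB (big_cat_nat (n := K)) //=.
apply: le_lt_trans (ler_normD _ _) _.
have : `|\sum_(0 <= j < K) (a j n - l j)| < e / 4.
  apply: le_lt_trans (ler_norm_sum _ _ _) _; rewrite big_mkord.
  apply: le_lt_trans (ler_norm _) _.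
  by near: n; move/cvgr0Pnorm_lt: cK; exact.
have : `|\sum_(K <= j < n.+1) (a j n - l j)| <= e / 4 + e / 4.
  apply: le_trans (ler_norm_sum _ _ _) _.
  apply: le_trans (_ : \sum_(K <= j < n.+1) (B j + B j) <= _).
    by apply: ler_sum => j _; apply: le_trans (ler_normB _ _) _; rewrite lerD.
  by rewrite big_split /= lerD // tail.
by lra.
Unshelve. all: by end_near. Qed.

End Tannery.

Section EulerLimits.
Variables (R : realType) (P : R).
Hypotheses (P_gt0 : 0 < P) (P_le : P <= 2^-1).

(** The q-Pochhammer symbol (x; x)_n. *)
Definition euler_phi (x : R) n : R := \prod_(i < n) (1 - x ^+ i.+1).

(** Euler's coefficient of U^j in the infinite product of the 1 - P^i U over i >= 1. *)
Definition euler_num_lim j : R := \prod_(i < j) (- P ^+ i.+1 / (1 - P ^+ i.+1)).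

Let P_lt1 : P < 1.
Proof. by have := P_le; lra. Qed.

Let Pn_gt0 i : 0 < P ^+ i.
Proof. exact: exprn_gt0. Qed.

Let Pn_le i : P ^+ i.+1 <= 2^-1.
Proof.
by rewrite exprS; apply: le_trans (P_le); rewrite ler_piMr ?exprn_ile1 ?ltW.
Qed.

Lemma cvg_expS0 : (fun N => P ^+ N.+1) @ \oo --> (0 : R).
Proof.
rewrite (cvg_shiftS (GRing.exp P)); apply: cvg_expr.
by rewrite ger0_norm ?(ltW P_gt0).
Qed.

Lemma cvg_euler_num j : (fun N => euler_num P N j) @ \oo --> euler_num_lim j.
Proof.
apply: (@cvg_prod_ord R j
  (fun i N => (P ^+ N.+1 - P ^+ i.+1) / (1 - P ^+ i.+1))
  (fun i => - P ^+ i.+1 / (1 - P ^+ i.+1))) => i.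
apply: cvgMr_tmp; rewrite -[X in _ --> X]sub0r; apply: cvgB; last exact: cvg_cst.
exact: cvg_expS0.
Qed.

(** A summable majorant uniform in N, as [tannery] requires. For P <= 1/2 the first factor is at
    most 1 and each later one at most 1/2, whence the constant 2. *)
Lemma euler_num_bound N j : `|euler_num P N j| <= 2 * 2^-1 ^+ j.
Proof.
have [lt_Nj|le_jN] := ltnP N j.
  by rewrite euler_num_eq0 // normr0 mulr_ge0 // exprn_ge0 // invr_ge0.
rewrite normr_prod.
have fact_le (i : 'I_j) : `|(P ^+ N.+1 - P ^+ i.+1) / (1 - P ^+ i.+1)| <=
    P ^+ i.+1 / (1 - P ^+ i.+1).
  have := Pn_le i => Pi.
  rewrite normrM normfV (@ger0_norm _ (1 - _)); last lra.
  rewrite ler_pM2r ?invr_gt0; last lra.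
  have PN : P ^+ N.+1 <= P ^+ i.+1.
    apply: ler_wiXn2l; [exact: ltW | exact: ltW |].
    by rewrite ltnS ltnW // (leq_trans (ltn_ord i)).
  by rewrite ler0_norm; have := Pn_gt0 N.+1; lra.
case: j le_jN fact_le => [|j] le_jN fact_le; first by rewrite big_ord0 expr0; lra.
rewrite big_ord_recl [leRHS](_ : _ = 1 * 2^-1 ^+ j); last first.
  by rewrite exprS mulrA divff.
apply: ler_pM => //; first by rewrite prodr_ge0.
  apply: le_trans (fact_le ord0) _; rewrite /= expr1.
  by have Ph := P_le; have P1 := P_lt1; rewrite ler_pdivrMr; lra.
rewrite -[X in 2^-1 ^+ X](card_ord j) -prodr_const; apply: ler_prod => i _.
rewrite normr_ge0 /=; apply: le_trans (fact_le (lift ord0 i)) _.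
have Pi := Pn_le i; have Pi0 := Pn_gt0 i.+1.
rewrite /= /bump /= add1n exprS.
(* For t <= 1/4 the quotient t / (1 - t) is at most 1/3. *)
have Ph := P_le; have P0 := P_gt0; have : P * P ^+ i.+1 <= 4^-1 by nra.
move: (P * P ^+ i.+1) => t t_le.
by rewrite ler_pdivrMr; lra.
Qed.

Lemma euler_num_lim_bound j : `|euler_num_lim j| <= 2 * 2^-1 ^+ j.
Proof.
have c : (fun N => `|euler_num P N j|) @ \oo --> `|euler_num_lim j|.
  exact: cvg_norm (@cvg_euler_num j).
rewrite -(cvg_lim _ c) //; apply: limr_le; first exact: cvgP c.
by apply: nearW => N; exact: euler_num_bound.
Qed.

(** Induction needs the stronger bound 1/4 + P^n / 2 for n >= 1, whose decreasing second term pays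
    for the next factor; it is an equality at n = 1, P = 1/2. *)
Lemma euler_phi_ge n : 4^-1 <= euler_phi P n.
Proof.
case: n => [|n]; first by rewrite /euler_phi big_ord0; lra.
suff : 4^-1 + 2^-1 * P ^+ n.+1 <= euler_phi P n.+1.
  by have := Pn_gt0 n.+1; lra.
elim: n => [|n IHn].
  by have Ph := P_le; rewrite /euler_phi big_ord1 expr1; lra.
rewrite /euler_phi big_ord_recr /= -/(euler_phi P n.+1).
have Pn := Pn_le n; have Pn0 := Pn_gt0 n.+1.
apply: le_trans (_ : (4^-1 + 2^-1 * P ^+ n.+1) * (1 - P ^+ n.+2) <= _); last first.
  by rewrite ler_wpM2r // subr_ge0; have := Pn_le n.+1; lra.
rewrite exprS; move: (P ^+ n.+1) Pn Pn0 => t t_le t0.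
have Ph := P_le; have P0 := P_gt0.
have : P * t <= 2^-1 * t by rewrite ler_wpM2r // ltW.
have Pt4 : P * t <= 4^-1 by nra.
have : P * t * t <= 4^-1 * t by rewrite ler_wpM2r // ltW.
by nra.
Qed.

Lemma is_cvg_euler_phi : cvgn (euler_phi P).
Proof.
apply: nonincreasing_is_cvgn; last first.
  by exists 4^-1 => _ [n _ <-]; exact: euler_phi_ge.
apply/nonincreasing_seqP => n; rewrite /euler_phi big_ord_recr /=.
rewrite ler_piMr //; first by apply: le_trans (euler_phi_ge n).
by rewrite gerBl ltW.
Qed.

Lemma lim_euler_phi_gt0 : 0 < limn (euler_phi P).
Proof.
apply: lt_le_trans (_ : 4^-1 <= _); first by rewrite invr_gt0.
apply: limr_ge; first exact: is_cvg_euler_phi.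
by apply: nearW => n; exact: euler_phi_ge.
Qed.

Lemma is_cvg_series_half : cvgn (series (fun j => 2 * 2^-1 ^+ j : R)).
Proof.
by apply: is_cvg_geometric_series; rewrite ger0_norm ?invr_ge0 // invf_lt1 // ltr1n.
Qed.

Lemma sum_euler_num N : \sum_(j < N.+1) euler_num P N j = euler_phi P N.
Proof.
have P1 i : P ^+ i.+1 != 1 by rewrite lt_eqF //; have := Pn_le i; lra.
have := prod_euler_num P1 N (1 : R^o).
under eq_bigr do rewrite [_ *: _]mulr1.
under [in RHS]eq_bigr do rewrite expr1n [_ *: _]mulr1.
by move=> <-.
Qed.

(** Euler's expansion at U = 1, obtained from the finite identity by [tannery]. *)
Lemma sum_euler_num_lim : limn (series euler_num_lim) = limn (euler_phi P).
Proof.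
have := tannery (fun N j => euler_num_bound N j) is_cvg_series_half cvg_euler_num.
by under eq_fun do rewrite sum_euler_num; move=> /cvg_lim ->.
Qed.

End EulerLimits.

(** * Closed form and limit of b_n(d) *)

Section BcoefLimit.
Variables (R : realType) (q d : nat).
Hypotheses (q_gt1 : (1 < q)%N) (d_gt0 : (0 < d)%N).
Local Notation p := (q%:R^-1 : R).

Lemma invn_gt0 : 0 < p.
Proof. by rewrite invr_gt0 ltr0n ltnW. Qed.

Lemma invn_le_half : p <= 2^-1.
Proof. by rewrite lef_pV2 ?posrE ?ltr0n // ?ler_nat // ltnW. Qed.

Lemma invn_exp_le_half : p ^+ d <= 2^-1.
Proof.
apply: le_trans invn_le_half; rewrite -[leRHS]expr1.
apply: ler_wiXn2l => //; by have := invn_le_half; have := invn_gt0; lra.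
Qed.

Let P_gt0 : 0 < p ^+ d.
Proof. by rewrite exprn_gt0 // invn_gt0. Qed.

Let P_le := invn_exp_le_half.

Lemma cvg_euler_den n :
  (fun N => euler_den p N n) @ \oo --> (euler_phi p n)^-1.
Proof.
rewrite /euler_phi -prodfV.
apply: (@cvg_prod_ord R n (fun i N => (1 - p ^+ (N + i)) / (1 - p ^+ i.+1))
   (fun i => (1 - p ^+ i.+1)^-1)) => i.
rewrite -[X in _ --> X]mul1r; apply: cvgMr_tmp.
rewrite -[X in _ --> X]subr0; apply: cvgB; first exact: cvg_cst.
rewrite (cvg_shiftn i (GRing.exp p)); apply: cvg_expr.
by rewrite ger0_norm ?(ltW invn_gt0) //; have := invn_le_half; lra.
Qed.

Lemma bcoefE n : bcoef R q d n =
  \sum_(j < n.+1) euler_num_lim (p ^+ d) j *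
    if (d * j <= n)%N then (euler_phi p (n - d * j))^-1 else 0.
Proof.
apply: cvg_lim => //.
pose u j N := euler_num (p ^+ d) N j *
  if (d * j <= n)%N then euler_den p N (n - d * j) else 0.
apply: (@cvg_trans _ ((fun N => \sum_(j < n.+1) u j N) @ \oo)).
  apply: near_eq_cvg; near=> N; rewrite bprodE // /u.
  have le_nN : (n <= N)%N by near: N; exists n.
  (* Since d >= 1, the summands with j > n vanish, so the number of terms no longer depends on N. *)
  rewrite (big_ord_widen N.+1 (fun j => u j N)) // big_mkcond /=.
  apply: eq_bigr => j _; case: ifP => // /negbT; rewrite -leqNgt /u => lt_nj.
  by rewrite leqNgt (leq_trans lt_nj) ?leq_pmull // mulr0.
apply: (@cvg_sum_ord R n.+1 u (fun j => euler_num_lim (p ^+ d) j *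
    if (d * j <= n)%N then (euler_phi p (n - d * j))^-1 else 0)) => j.
apply: cvgM; first exact: cvg_euler_num.
by case: ifP => _; [exact: cvg_euler_den | exact: cvg_cst].
Unshelve. all: by end_near. Qed.

(** In the closed form each denominator tends to the limit of [euler_phi p], and the remaining
    series is Euler's expansion at U = 1. *)
Lemma cvg_bcoef :
  bcoef R q d @ \oo --> limn (euler_phi (p ^+ d)) / limn (euler_phi p).
Proof.
have p0 := invn_gt0; have ph := invn_le_half.
pose l := limn (euler_phi p).
have l0 : l != 0 by rewrite gt_eqF // lim_euler_phi_gt0.
pose a j n := euler_num_lim (p ^+ d) j *
  if (d * j <= n)%N then (euler_phi p (n - d * j))^-1 else 0.
rewrite (_ : bcoef R q d = fun n => \sum_(j < n.+1) a j n); last first.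
  by apply/funext => n; rewrite bcoefE.
(* The factor 4 bounds the inverse of [euler_phi], which is at least 1/4. *)
have cB : cvgn (series (4 *: (fun j => 2 * 2^-1 ^+ j : R))).
  by rewrite seriesZ; apply: is_cvgZr; exact: is_cvg_series_half.
rewrite -(sum_euler_num_lim P_gt0 P_le).
have -> : limn (series (euler_num_lim (p ^+ d))) / l =
    limn (series (l^-1 *: euler_num_lim (p ^+ d))).
  have cS : cvgn (series (euler_num_lim (p ^+ d))).
    apply: normed_cvg.
    apply: (@series_le_cvg R (fun j => `|euler_num_lim (p ^+ d) j|)
      (fun j => 2 * 2^-1 ^+ j)) => [n|n|n|].
    - exact: normr_ge0.
    - by rewrite mulr_ge0 // exprn_ge0 // invr_ge0.
    - exact: euler_num_lim_bound.
    - exact: is_cvg_series_half.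
  by rewrite seriesZ (limZl_tmp l^-1 cS) mulrC.
apply: tannery cB _.
  move=> n j; rewrite normrM -[leRHS]/(4 * (2 * 2^-1 ^+ j)) [leRHS]mulrC.
  apply: ler_pM => //.
    exact: euler_num_lim_bound.
  case: ifP => _; last by rewrite normr0.
  have := euler_phi_ge p0 ph (n - d * j) => ge4.
  rewrite ger0_norm ?invr_ge0; last by lra.
  by rewrite -[leRHS]invrK lef_pV2 ?posrE; lra.
move=> j.
rewrite [X in _ --> X](_ : _ = euler_num_lim (p ^+ d) j * l^-1); last first.
  exact: mulrC.
apply: cvgMl_tmp.
apply: (@cvg_trans _ ((fun n => (euler_phi p (n - d * j))^-1) @ \oo)).
  apply: near_eq_cvg; near=> n.
  by have -> : (d * j <= n)%N by near: n; exists (d * j)%N.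
rewrite (cvg_centern (d * j) (fun n => (euler_phi p n)^-1)).
by apply: cvgV => //; exact: is_cvg_euler_phi.
Unshelve. all: by end_near. Qed.

End BcoefLimit.

(** * Matching the counting formula with b_n(d) *)

Section ProbabilityFormula.
Variables (R : realType) (q : nat).
Hypothesis q_gt1 : (1 < q)%N.
Local Notation p := (q%:R^-1 : R).

Let q0 : (q%:R : R) != 0.
Proof. by rewrite pnatr_eq0 -lt0n ltnW. Qed.

Let phi_neq0 n : euler_phi p n != 0.
Proof.
have := euler_phi_ge (invn_gt0 R q_gt1) (invn_le_half R q_gt1) n => ge4.
by rewrite gt_eqF //; apply: lt_le_trans ge4; rewrite invr_gt0.
Qed.

(** The factors are 1 - p^(n-i), so the product telescopes into a ratio; for m > n the factor i = n
    vanishes. *)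
Lemma prod_1sub_exp n m :
  \prod_(i < m) (1 - q%:R ^+ i / q%:R ^+ n) =
  if (m <= n)%N then euler_phi p n / euler_phi p (n - m) else 0.
Proof.
case: leqP => [|lt_nm]; last first.
  apply/eqP/prodf_eq0; exists (Ordinal lt_nm) => //=.
  by rewrite divff ?subrr // expf_neq0.
elim: m => [|m IHm] le_mn; first by rewrite big_ord0 subn0 divff.
rewrite big_ord_recr /= {}IHm 1?ltnW //.
have -> : (n - m = (n - m.+1).+1)%N by rewrite -subSn.
rewrite /euler_phi [in X in _ / X * _]big_ord_recr /=.
rewrite -/(euler_phi p _) -/(euler_phi p _).
have -> : q%:R ^+ m / q%:R ^+ n = p ^+ (n - m.+1).+1 :> R.
  rewrite -subSn // subSS exprVn; apply: (mulIf (expf_neq0 n q0)).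
  rewrite divfK ?expf_neq0 // -{2}(subnK (ltnW le_mn)) exprD mulrA mulVf ?mul1r //.
  exact: expf_neq0.
have D0 : 1 - p ^+ (n - m.+1).+1 != 0.
  by rewrite subr_eq0 eq_sym invn_exp_neq1.
by have := phi_neq0 (n - m.+1) => E0; field; rewrite E0 D0.
Qed.

Lemma euler_num_lim_inv d j : (0 < d)%N ->
  \prod_(i < j) (- ((q%:R ^+ d) ^+ i.+1 - 1)^-1) = euler_num_lim (p ^+ d) j :> R.
Proof.
move=> d_gt0; apply: eq_bigr => i _; rewrite !exprVn.
have := invn_exp_neq1 R q_gt1 (d * i.+1).-1.
rewrite prednK ?muln_gt0 ?d_gt0 // exprM !exprVn.
have : (q%:R ^+ d) ^+ i.+1 != 0 :> R by rewrite !expf_neq0.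
move: (_ ^+ i.+1) => Y Y0 Y1; rewrite -subr_eq0 in Y1.
have Y2 : Y - 1 != 0.
  by apply: contraNneq Y1 => /subr0_eq ->; rewrite invr1 subrr.
have Y3 : 1 - Y^-1 != 0 by rewrite -opprB oppr_eq0.
by field; rewrite Y0 Y2.
Qed.

Lemma euler_phiE n :
  \prod_(1 <= i < n.+1) (1 - q%:R ^- i) = euler_phi p n :> R.
Proof.
by rewrite big_add1 big_mkord; apply: eq_bigr => i _; rewrite exprVn.
Qed.

(** The sums agree term by term: the inversion weights are Euler's coefficients, and the
    independence probabilities supply the ratios of [euler_phi]. *)
Lemma bcoef_euler_phi d n : (0 < d)%N ->
  bcoef R q d n * euler_phi p n =
  \sum_(j < n.+1) (\prod_(i < j) (- ((q%:R ^+ d) ^+ i.+1 - 1)^-1)) *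
    \prod_(i < d * j) (1 - q%:R ^+ i / q%:R ^+ n).
Proof.
move=> d_gt0; rewrite bcoefE // mulr_suml; apply: eq_bigr => j _.
rewrite euler_num_lim_inv // prod_1sub_exp -mulrA; congr (_ * _).
by case: ifP => _; rewrite ?mul0r // mulrC.
Qed.

Lemma infprod_phi d : (0 < d)%N ->
  infprod (fun i => 1 - q%:R ^- (i * d)) = limn (euler_phi (p ^+ d)) :> R.
Proof.
move=> d_gt0; rewrite /infprod; congr (limn _); apply/funext => N.
rewrite big_add1 big_mkord; apply: eq_bigr => i _.
by rewrite -exprM exprVn mulnC.
Qed.

Lemma infprod_ratio d : (0 < d)%N ->
  infprod (fun i => (1 - q%:R ^- (i * d)) / (1 - q%:R ^- i)) =
  limn (euler_phi (p ^+ d)) / limn (euler_phi p) :> R.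
Proof.
move=> d_gt0; have p0 := invn_gt0 R q_gt1; have ph := invn_le_half R q_gt1.
have P0 : 0 < p ^+ d by exact: exprn_gt0.
have P_le := invn_exp_le_half R q_gt1 d_gt0.
apply: cvg_lim => //.
rewrite (_ : (fun N => _) = fun N => euler_phi (p ^+ d) N / euler_phi p N).
  apply: cvgM; first exact: is_cvg_euler_phi.
  apply: cvgV; first by rewrite gt_eqF // lim_euler_phi_gt0.
  exact: is_cvg_euler_phi.
apply/funext => N; rewrite big_add1 big_mkord prodf_div.
congr (_ / _); apply: eq_bigr => i _; last by rewrite exprVn.
by rewrite -exprM exprVn mulnC.
Qed.

(** For d = 0, where the Euler expansions do not apply, every factor has numerator 1 - 1 = 0. *)
Lemma bcoef0 n : bcoef R q 0 n = 0.
Proof.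
apply: cvg_lim => //; apply: cvg_near_cst; exists 1%N => // -[|N] //= _.
rewrite big_ltn // {1}/bfactor /fps_div expr0 subrr.
rewrite /fps_mul big1 // => i _; rewrite /fps_of_poly big1 ?mul0r // => l _.
by rewrite coef0 mul0r.
Qed.

Lemma infprod_ratio0 :
  infprod (fun i => (1 - q%:R ^- (i * 0)) / (1 - q%:R ^- i)) = 0 :> R.
Proof.
apply: cvg_lim => //; apply: cvg_near_cst; exists 1%N => // -[|N] //= _.
by rewrite big_ltn // muln0 expr0 invr1 subrr !mul0r.
Qed.

Lemma cvg_bcoef_infprod d :
  bcoef R q d @ \oo -->
    infprod (fun i => (1 - q%:R ^- (i * d)) / (1 - q%:R ^- i) : R).
Proof.
case: d => [|d]; last by rewrite infprod_ratio //; exact: cvg_bcoef.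
rewrite infprod_ratio0 (_ : bcoef R q 0 = cst 0); first exact: cvg_cst.
by apply/funext => n; rewrite bcoef0.
Qed.

End ProbabilityFormula.

(** * Transfer from the residue field to the ring *)

Section MainFormula.
Variables (R : realType) (O : idomainType) (m : set O) (k : finFieldType).
Variables (rho : {rmorphism O -> k}) (P : {poly O}).
Hypotheses (O_dvr : is_dvr m) (rho_surj : forall y : k, exists x : O, rho x = y).
Hypothesis rho_ker : forall x : O, rho x = 0 <-> m x.
Hypotheses (P_monic : P \is monic) (P_irr : irreducible_poly (map_poly rho P)).

Lemma size_map_poly_monic : size (map_poly rho P) = size P.
Proof.
by apply: size_poly_eq; rewrite -lead_coefE (monicP P_monic) rmorph1 oner_neq0.
Qed.

Lemma deg_gt0 : (0 < (size P).-1)%N.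
Proof.
by have [+ _] := P_irr; rewrite size_map_poly_monic; case: (size P) => [|[]].
Qed.

Lemma prob_coker0 n (mu : probability (borel_mx m n) R) : is_haar mu ->
  mu [set A : 'M[O]_n | coker_eq0 (poly_mx P A)] =
  (bcoef R #|k| (size P).-1 n * \prod_(1 <= i < n.+1) (1 - #|k|%:R ^- i))%:E.
Proof.
move=> haar; have q1 : (1 < #|k|)%N := card_finNzRing_gt1 k.
rewrite euler_phiE bcoef_euler_phi ?deg_gt0 //.
case: n mu haar => [|n] mu haar.
  (* For n = 0 the empty matrix is invertible, and both sides equal 1. *)
  rewrite big_ord1 muln0 !big_ord0 mulr1 -(probability_setT mu); congr (mu _).
  apply/seteqP; split=> // A _; apply/coker_eq0P.
  by rewrite unitmxE det_mx00 unitr1.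
have [_ [m_ideal _ _] _ _] := O_dvr.
pose S := [pred B : 'M[k]_n.+1 | horner_mx B (map_poly rho P) \in unitmx].
rewrite [X in mu X](_ : _ = [set A : 'M[O]_n.+1 | S (map_mx rho A)]); last first.
  by apply/seteqP; split=> A /=; rewrite -map_poly_mx
    -(unitmx_rho rho_ker) // => /coker_eq0P.
have Pm : map_poly rho P \is monic by exact: monic_map.
rewrite (haar_residue rho_surj rho_ker m_ideal haar).
have sizeP : size (map_poly rho P) = (size P).-2.+2.
  by rewrite size_map_poly_monic; have := deg_gt0; case: (size P) => [|[]].
(* The cutoff J = n+1 is the matrix size, giving the same range of summation as in
   [bcoef_euler_phi]. *)
rewrite (prob_horner_mx_unit sizeP Pm P_irr R (ltnSn n)).
by congr EFin; have := deg_gt0; case: (size P) => [|[|s]].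
Qed.

End MainFormula.

Theorem theorem1 (R : realType) (O : idomainType) (m : set O)
    (k : finFieldType) (rho : {rmorphism O -> k}) (P : {poly O})
    (mu : forall n : nat, probability (borel_mx m n) R)
    (O_dvr : is_dvr m) (O_complete : adic_complete m)
    (rho_surj : forall y : k, exists x : O, rho x = y)
    (rho_ker : forall x : O, rho x = 0 <-> m x)
    (P_monic : P \is monic) (P_irr : irreducible_poly (map_poly rho P))
    (mu_haar : forall n : nat, is_haar (mu n)) :
  let q := #|k| in
  let deg := (size P).-1 in
  let prob (n : nat) := mu n [set A : 'M[O]_n | coker_eq0 (poly_mx P A)] in
  [/\ forall n : nat,
        prob n = (bcoef R q deg n * \prod_(1 <= i < n.+1) (1 - q%:R ^- i))%:E,
      forall d : nat,
        bcoef R q d n @[n --> \oo] -->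
          infprod (fun i => (1 - q%:R ^- (i * d)) / (1 - q%:R ^- i) : R) &
      prob n @[n --> \oo] --> (infprod (fun i => 1 - q%:R ^- (i * deg)))%:E].
Proof.
move=> q deg prob; have q1 : (1 < q)%N := card_finNzRing_gt1 k.
have deg0 : (0 < deg)%N by exact: deg_gt0 P_monic P_irr.
have probE n : prob n =
    (bcoef R q deg n * \prod_(1 <= i < n.+1) (1 - q%:R ^- i))%:E.
  exact: (prob_coker0 O_dvr rho_surj rho_ker P_monic P_irr (mu_haar n)).
split=> //; first by move=> d; exact: cvg_bcoef_infprod.
under eq_fun do rewrite probE euler_phiE.
apply: cvg_EFin; first exact: nearW.
have phi0 : limn (euler_phi (q%:R^-1 : R)) != 0.
  by rewrite gt_eqF // lim_euler_phi_gt0 ?invn_gt0 ?invn_le_half.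
(* The target is written as the limit of b_n times the limit of [euler_phi], so that limits can be
   multiplied. *)
rewrite infprod_phi // -[X in _ --> X](divfK phi0).
apply: cvgM; first exact: cvg_bcoef.
by apply: is_cvg_euler_phi; [exact: invn_gt0 | exact: invn_le_half].
Qed.
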